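(* Let $z=x+iy\in\mathbb{C}$ with $y>0$, let $\Lambda=\mathbb{Z}z+\mathbb{Z}$, and let $s>-1$ be real. Then $$\sum_{\substack{(\omega_1,\omega_2,\omega_3)\in\Lambda^3\\ \omega_1+\omega_2+\omega_3=0,\ \det(\omega_1\ \omega_2)\neq 0}}\frac{|\det(\omega_1\ \omega_2)|^{-s}}{|\omega_1\omega_2\omega_3|^2}=\frac{6\pi}{y^3}\,\zeta(s+3)\,\zeta(s+2),$$ where the sum runs over ordered triples and $\zeta$ is the Riemann zeta function.
   Context: For $\omega_k=m_kz+n_k\in\Lambda$ ($m_k,n_k\in\mathbb{Z}$), $\det(\omega_1\ \omega_2)$ denotes the determinant $m_1n_2-m_2n_1$ of the integer coordinate vectors of $\omega_1,\omega_2$ with respect to the basis $z,1$ of $\Lambda$; the condition $\det(\omega_1\ \omega_2)\neq 0$ excludes exactly the triples in which the $\omega_k$ are collinear (including those where some $\omega_k=0$). $|\cdot|$ is the complex absolute value. *)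

(* Defs.v *)
From HB Require Import structures.
From mathcomp Require Import all_boot all_order all_algebra.
From mathcomp Require Import all_classical all_reals all_analysis.
From mathcomp Require Import complex.

Set Implicit Arguments.
Unset Strict Implicit.
Unset Printing Implicit Defensive.

Import Order.TTheory GRing.Theory Num.Theory.
Import numFieldNormedType.Exports.

Local Open Scope classical_set_scope.
Local Open Scope ring_scope.

Section Lattice.
Variable R : realType.
Implicit Types (z w : R[i]) (p : int * int).

Definition lattice_point z p : R[i] := p.1%:~R * z + p.2%:~R.

Definition lattice z : set R[i] := range (lattice_point z).

(* The coordinates (m, n) of w = m z + n in the basis z, 1; they are unique when
   Im z <> 0. The default (0, 0) is used only when w is not in the lattice. *)
Definition lattice_coord z w : int * int :=
  xget (0, 0) [set p | lattice_point z p = w].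

Definition lattice_det z w1 w2 : int :=
  let: (m1, n1) := lattice_coord z w1 in
  let: (m2, n2) := lattice_coord z w2 in
  m1 * n2 - m2 * n1.

Definition lattice_triples z : set (R[i] * R[i] * R[i]) :=
  [set t | [/\ lattice z t.1.1, lattice z t.1.2 & lattice z t.2] /\
           t.1.1 + t.1.2 + t.2 = 0 /\ lattice_det z t.1.1 t.1.2 <> 0].

End Lattice.

(* The Dirichlet series of the Riemann zeta function; it is meaningful only for
   real s > 1, where it converges. *)
Definition zeta (R : realType) (s : R) : R :=
  limn (series (fun n : nat => n.+1%:R `^ (- s))).

(* Main.v *)
Require Import Defs.
From mathcomp Require Import all_boot all_order all_algebra.
From mathcomp Require Import all_classical all_reals all_analysis.
From mathcomp Require Import complex.
From mathcomp Require Import ring lra zify.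

Set Implicit Arguments.
Unset Strict Implicit.

Import Order.TTheory GRing.Theory Num.Theory.
Import numFieldNormedType.Exports.

Local Open Scope classical_set_scope.
Local Open Scope ring_scope.
Local Open Scope complex_scope.

(** In coordinates the sum runs over pairs (u, v) of integer vectors with
    det(u, v) <> 0, the summand being |det|^-s / (Q(u) Q(v) Q(u + v)) where
    Q(m, n) = |m z + n|^2 and <,> is the associated inner product.

    Put d = y det(u, v) > 0, so that <u, v> / d is the cotangent of the angle
    from u to v, and E(t) = pi - 2 atan t - 2 t / (1 + t^2).  Writing E(u, v) for
    E(<u, v> / d), one has
      E(u, v) - E(u, u + v) - E(u + v, v) = 4 d^3 / (Q(u) Q(v) Q(u + v)),
    because angles are additive.  Hence the sum of 1 / (Q(u) Q(v) Q(u + v)) over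
    the binary tree generated from a pair by (u, v) |-> (u, u + v), (u + v, v)
    telescopes to E(u, v) / (4 d^3).

    The summand is invariant under the swap of u and v and under the rotation
    (u, v) |-> (-v, u + v) of order 6, so only the pairs with det > 0 and first
    coordinates m_1 > 0, m_2 >= 0 matter, with multiplicity 12.  Euclid's
    algorithm on (m_1, m_2) shows that these are the pairs ((a, b), (0, e)) with
    a, e >= 1 and b in Z, together with the trees grown from
    ((a, b), (a, b + e)).  For given a, b, e their contributions add up to
    (ae)^-s (E(t_b) - E(t_(b+e))) / (4 (aey)^3) with t_b = (ax + b) / (ay), and
    the sum over b in Z telescopes to (ae)^-s 2 pi e / (4 (aey)^3).  Summing over
    a and e gives the two zeta values. *)

(** * The function E: monotonicity, decay at infinity, splitting identity *)

Section Segment.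
Variable R : realType.
Implicit Types t u a b h d : R.

(** With t = cot θ and 0 < θ < pi this is 2 θ - sin (2 θ), twice the area of the circular segment of
    central angle 2 θ in the unit disc. *)
Definition segment_area t : R := pi - 2 * atan t - 2 * t / (1 + t ^+ 2).

Lemma add1_sqr_gt0 t : 0 < 1 + t ^+ 2.
Proof. by rewrite ltr_pwDl// sqr_ge0. Qed.

Lemma is_derive_segment_area t :
  is_derive t 1 segment_area (- 4 / (1 + t ^+ 2) ^+ 2).
Proof.
have t0 : 1 + t ^+ 2 != 0 by rewrite gt_eqF// add1_sqr_gt0.
have dv : is_derive t 1 (fun u : R => (1 + u ^+ 2)^-1)
    (- (1 + t ^+ 2) ^- 2 *: (2 * t)).
  apply: is_deriveV => //.
  apply: is_derive_eq; rewrite /GRing.scale/=; ring.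
rewrite /segment_area; apply: is_derive_eq.
rewrite /GRing.scale/=; field.
exact: t0.
Qed.

Lemma derive_ge0_le {f df : R -> R} {t u} :
  (forall v : R, is_derive v 1 f (df v)) -> t <= u ->
  (forall v, t <= v -> v <= u -> 0 <= df v) -> f t <= f u.
Proof.
move=> fdf tu df0; rewrite -subr_ge0.
have [|c + ->] := @MVT_segment _ f df t u tu (fun v _ => fdf v).
  apply: continuous_subspaceT => v.
  by apply/differentiable_continuous/derivable1_diffP; have [] := fdf v.
rewrite in_itv/= => /andP[tc cu].
by rewrite mulr_ge0 ?subr_ge0// df0.
Qed.

Lemma segment_area_nonincreasing : {homo segment_area : t u / t <= u >-> u <= t}.
Proof.
move=> t u tu; rewrite -lerN2.
have dN (v : R) : is_derive v 1 (- segment_area) (- (- 4 / (1 + v ^+ 2) ^+ 2)).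
  by have ds := is_derive_segment_area v; exact: is_deriveN.
apply: (derive_ge0_le dN tu).
by move=> v _ _; rewrite mulNr opprK divr_ge0// sqr_ge0.
Qed.

Lemma cvgy_inv1Dsqr : ((1 + t ^+ 2)^-1 : R) @[t --> +oo] --> (0 : R).
Proof.
apply/cvgrPdist_le => e e0; near=> t.
rewrite sub0r normrN ger0_norm; last by rewrite invr_ge0 ltW// add1_sqr_gt0.
have t0 : 1 <= t by near: t; apply: nbhs_pinfty_ge; exact: num_real.
have te : e^-1 <= t by near: t; apply: nbhs_pinfty_ge; exact: num_real.
rewrite invf_ple ?posrE ?add1_sqr_gt0//.
by apply: (le_trans te); nra.
Unshelve. all: by end_near. Qed.

Lemma cvgy_linear_inv1Dsqr : (2 * t / (1 + t ^+ 2) : R) @[t --> +oo] --> (0 : R).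
Proof.
apply/cvgrPdist_le => e e0; near=> t.
have t0 : 1 <= t by near: t; apply: nbhs_pinfty_ge; exact: num_real.
have te : 2 / e <= t by near: t; apply: nbhs_pinfty_ge; exact: num_real.
rewrite sub0r normrN ger0_norm; last first.
  by rewrite divr_ge0 ?ltW ?add1_sqr_gt0//; nra.
rewrite ler_pdivrMr ?add1_sqr_gt0//.
have te' : 2 <= t * e by rewrite -ler_pdivrMr.
nra.
Unshelve. all: by end_near. Qed.

Lemma cvgy_segment_area : segment_area t @[t --> +oo] --> (0 : R).
Proof.
have -> : (0 : R) = pi - 2 * (pi / 2) - 0 by field.
apply: cvgB cvgy_linear_inv1Dsqr.
apply: cvgB; first exact: cvg_cst.
apply: cvgM; [exact: cvg_cst|exact: cvgy_atan].
Qed.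

Lemma segment_areaN t : segment_area (- t) = 2 * pi - segment_area t.
Proof.
rewrite /segment_area atanN sqrrN; ring.
Qed.

Lemma segment_area_ge0 t : 0 <= segment_area t.
Proof.
apply: (ler_cvg_to cvgy_segment_area (cvg_cst (segment_area t))).
near=> u; apply: segment_area_nonincreasing; near: u; apply: nbhs_pinfty_ge; exact: num_real.
Unshelve. all: by end_near. Qed.

Lemma segment_area_le2pi t : segment_area t <= 2 * pi.
Proof.
by have := segment_area_ge0 (- t); rewrite segment_areaN subr_ge0.
Qed.

(** The difference of the two sides is nondecreasing for t >= 1 and tends to 0 at infinity, so it is
    never positive there. The true order is t^-3, but quadratic decay suffices and fits the factor 1
    + cot^2 met later. *)
Lemma segment_area_le_inv1Dsqr t : 1 <= t -> segment_area t <= 2 / (1 + t ^+ 2).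
Proof.
move=> t1; pose g u := segment_area u - 2 / (1 + u ^+ 2).
pose dg u := (4 * u - 4) / (1 + u ^+ 2) ^+ 2.
have gdg (v : R) : is_derive v 1 g (dg v).
  have v0 : 1 + v ^+ 2 != 0 by rewrite gt_eqF// add1_sqr_gt0.
  have dv : is_derive v 1 (fun u : R => (1 + u ^+ 2)^-1)
      (- (1 + v ^+ 2) ^- 2 *: (2 * v)).
    apply: is_deriveV => //.
    by apply: is_derive_eq; rewrite /GRing.scale/=; ring.
  have ds := is_derive_segment_area v.
  rewrite /g /dg; apply: is_derive_eq.
  rewrite /GRing.scale/=; field; exact: v0.
have cg : g u @[u --> +oo] --> (0 : R).
  have -> : (0 : R) = 0 - 2 * 0 by ring.
  apply: cvgB cvgy_segment_area _.
  apply: cvgM; [exact: cvg_cst|exact: cvgy_inv1Dsqr].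
rewrite -subr_le0 -/(g t).
apply: (ler_cvg_to (cvg_cst (g t)) cg).
near=> u; have tu : t <= u by near: u; apply: nbhs_pinfty_ge; exact: num_real.
apply: (derive_ge0_le gdg tu).
move=> v tv _; rewrite divr_ge0 ?sqr_ge0// subr_ge0 ler_peMr//.
exact: le_trans tv.
Unshelve. all: by end_near. Qed.

Lemma segment_area_bound t0 : exists2 C : R, 0 <= C &
  forall t, t0 <= t -> segment_area t <= C / (1 + t ^+ 2).
Proof.
have p0 := pi_ge0 R.
have pt0 : 0 <= pi * t0 ^+ 2 by rewrite mulr_ge0// sqr_ge0.
(* The summand 2 serves t >= 1. The other serves t0 <= t < 1, where E <= 2 pi and t^2 <= 1 +
   t0^2. *)
exists (2 + 2 * pi * (2 + t0 ^+ 2)) => [|t t0t].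
  lra.
have [t1|t1] := leP 1 t.
  apply: (le_trans (segment_area_le_inv1Dsqr t1)).
  rewrite ler_pM2r ?invr_gt0 ?add1_sqr_gt0//.
  lra.
rewrite ler_pdivlMr ?add1_sqr_gt0//.
have t2 : 1 + t ^+ 2 <= 2 + t0 ^+ 2 by have [|] := leP 0 t; nra.
have E2 := segment_area_le2pi t.
have E0 := segment_area_ge0 t.
have := ler_pM E0 (ltW (add1_sqr_gt0 t)) E2 t2.
lra.
Qed.

(* Addition formula for the cotangent, as atan t = pi / 2 - arccot t. *)
Lemma atan_add t u : 0 < t + u ->
  atan ((t * u - 1) / (t + u)) = atan t + atan u - pi / 2.
Proof.
move=> tu0.
have [ht ht'] : - (pi / 2) < atan t /\ atan t < pi / 2.
  by rewrite atan_gtNpi2 atan_ltpi2.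
have [hu hu'] : - (pi / 2) < atan u /\ atan u < pi / 2.
  by rewrite atan_gtNpi2 atan_ltpi2.
have htu : 0 < atan t + atan u.
  by rewrite -ltrBlDr sub0r -atanN lt_atan// -subr_gt0 opprK.
have ct : cos (atan t) != 0 by rewrite gt_eqF// cos_gt0_pihalf// ht ht'.
have cu : cos (atan u) != 0 by rewrite gt_eqF// cos_gt0_pihalf// hu hu'.
have st : sin (atan t) = t * cos (atan t).
  by rewrite -[X in X * _]atanK /tan divfK.
have su : sin (atan u) = u * cos (atan u).
  by rewrite -[X in X * _]atanK /tan divfK.
rewrite -[RHS]tanK ?in_itv/=; last by apply/andP; split; lra.
congr atan.
rewrite /tan sinB cosB sin_pihalf cos_pihalf sinD cosD st su.
have tu : t + u != 0 by rewrite gt_eqF.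
field; rewrite tu andbT.
have -> : t * cos (atan t) * cos (atan u) + cos (atan t) * (u * cos (atan u)) =
  cos (atan t) * cos (atan u) * (t + u) by ring.
by rewrite !mulf_neq0.
Qed.

(** Here a = Q(u), b = Q(v), h = <u, v>, d = y det(u, v), so that a + b + 2 h = Q(u + v). The
    arctangents and the multiples of pi cancel by [atan_add]; a rational identity remains. *)
Lemma segment_area_split a b h d : 0 < a -> 0 < b -> 0 < d ->
  a * b = h ^+ 2 + d ^+ 2 ->
  segment_area (h / d) - segment_area ((a + h) / d) - segment_area ((b + h) / d)
  = 4 * d ^+ 3 / (a * b * (a + b + 2 * h)).
Proof.
move=> a0 b0 d0 abE.
have sqD0 u : 0 < u ^+ 2 + d ^+ 2 by rewrite ltr_wpDl ?sqr_ge0 ?exprn_gt0.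
have aE : a * (a + b + 2 * h) = (a + h) ^+ 2 + d ^+ 2.
  by rewrite !mulrDr abE; ring.
have bE : b * (a + b + 2 * h) = (b + h) ^+ 2 + d ^+ 2.
  by rewrite !mulrDr (mulrC b a) abE; ring.
have s0 : 0 < a + b + 2 * h by rewrite -(pmulr_rgt0 _ a0) aE.
have sE u : 2 * (u / d) / (1 + (u / d) ^+ 2) = 2 * (u * d / (u ^+ 2 + d ^+ 2)).
  by field; rewrite !gt_eqF// addrC.
rewrite /segment_area !sE -abE -aE -bE.
have -> : h / d = ((a + h) / d * ((b + h) / d) - 1) / ((a + h) / d + (b + h) / d).
  have -> : (a + h) / d * ((b + h) / d) - 1 = h * (a + b + 2 * h) / d ^+ 2.
    have -> : (a + h) / d * ((b + h) / d) = (a * b + h * (a + b) + h ^+ 2) / d ^+ 2.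
      by field; rewrite gt_eqF.
    by rewrite abE; field; rewrite gt_eqF.
  by field; rewrite !gt_eqF//; lra.
rewrite atan_add; last by rewrite -mulrDl divr_gt0//; lra.
(* Once d^2 is traded for a b - h^2, the identity holds for independent a, b, h, d and [field]
   closes it. *)
have -> : 4 * d ^+ 3 / (a * b * (a + b + 2 * h)) =
    4 * d * (a * b - h ^+ 2) / (a * b * (a + b + 2 * h)).
  by rewrite abE; congr (_ / _); ring.
field.
by rewrite !gt_eqF.
Qed.

End Segment.

(** * Sums of nonnegative families: scaling, telescoping, Dirichlet series *)

Section Series.
Variable R : realType.

Lemma esumZl (T : choiceType) (D : set T) (a : T -> \bar R) (c : R) :
  0 <= c -> (forall i, (0 <= a i)%E) ->
  \esum_(i in D) (c%:E * a i)%E = (c%:E * \esum_(i in D) a i)%E.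
Proof.
move=> c0 a0; have leZ (k : R) (b : T -> \bar R) : 0 <= k ->
    (forall i, (0 <= b i)%E) ->
    (\esum_(i in D) (k%:E * b i)%E <= k%:E * \esum_(i in D) b i)%E.
  move=> k0 b0; apply: ge_ereal_sup => _ [X [finX XD] <-].
  rewrite -ge0_mule_fsumr//; apply: lee_wpmul2l; first by rewrite lee_fin.
  by apply: ereal_sup_ubound; exists X.
apply/eqP; rewrite eq_le leZ//=; have [->|cn0] := eqVneq c 0.
  by rewrite mul0e; apply: esum_ge0 => i _; rewrite mul0e.
have {cn0}c0 : 0 < c by rewrite lt_def cn0.
(* The reverse inequality is the one already proved, for the factor c^-1 and the scaled family. *)
have := @leZ c^-1 (fun i => c%:E * a i)%E.
rewrite invr_ge0 ltW// => /(_ isT) h.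
rewrite -[leRHS]mul1e -(divff (lt0r_neq0 c0)) EFinM -muleA.
apply: lee_wpmul2l; first by rewrite lee_fin ltW.
apply: le_trans (h _); last by move=> i; rewrite mule_ge0// lee_fin ltW.
apply: le_esum => i _.
by rewrite muleA -EFinM mulVf ?mul1e// gt_eqF.
Qed.

Lemma esum_series (u : nat -> R) : (forall n, 0 <= u n) -> cvgn (series u) ->
  \esum_(n in [set: nat]) (u n)%:E = (limn (series u))%:E.
Proof.
move=> u0 cu; rewrite -nneseries_esumT => [|n]; last by rewrite lee_fin.
rewrite -EFin_lim//; apply: congr_lim; apply/funext => n /=.
by rewrite /series/= sumEFin.
Qed.

Lemma esum_telescope (u : nat -> R) l : (forall n, u n.+1 <= u n) ->
  u @ \oo --> l ->
  \esum_(n in [set: nat]) (u n - u n.+1)%:E = (u 0%N - l)%:E.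
Proof.
move=> du ul.
have sE : series (fun n => u n - u n.+1) = (fun n => u 0%N - u n).
  apply/funext => n; rewrite /series/=.
  elim: n => [|n IH]; first by rewrite big_geq// subrr.
  by rewrite big_nat_recr//= IH; ring.
have sl : series (fun n => u n - u n.+1) @ \oo --> u 0%N - l.
  by rewrite sE; apply: cvgB => //; exact: cvg_cst.
rewrite esum_series => [|n|]; first by congr _%:E; exact: cvg_lim.
  by rewrite subr_ge0.
by apply/cvg_ex; exists (u 0%N - l).
Qed.

(** Mean value theorem for v^-c, the derivative being estimated at the right end. It compares the
    terms of the zeta series with a telescoping series. *)
Lemma powR_decrement (c x : R) : 0 < c -> 0 < x ->
  c * (x + 1) `^ (- (c + 1)) <= x `^ (- c) - (x + 1) `^ (- c).
Proof.
move=> c0 x0.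
have dp (v : R) : 0 < v ->
    is_derive v 1 (fun v : R => v `^ (- c)) (- c * v `^ (- c - 1)).
  by move=> v0; exact: is_derive1_powR.
have x1 : x <= x + 1 by rewrite lerDl.
have [| |y + e] := @MVT_segment R (fun v => v `^ (- c))
    (fun v => - c * v `^ (- c - 1)) x (x + 1) x1.
- by move=> v; rewrite in_itv/= => /andP[xv _]; apply: dp; exact: lt_trans xv.
- apply: derivable_within_continuous => v; rewrite in_itv/= => /andP[xv _].
  by have [] := dp v (lt_le_trans x0 xv).
rewrite in_itv/= => /andP[xy yx].
have y0 : 0 < y by exact: lt_le_trans xy.
rewrite -[leRHS]opprB e addrAC subrr add0r mulr1 mulNr opprK.
rewrite ler_pM2l// -opprD !powRN lef_pV2 ?posrE ?powR_gt0//; last first.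
  exact: lt_le_trans yx.
by rewrite ge0_ler_powR ?nnegrE//; lra.
Qed.

Lemma is_cvg_zeta (p : R) : 1 < p ->
  cvgn (series (fun n : nat => n.+1%:R `^ (- p) : R)).
Proof.
move=> p1.
apply: nondecreasing_is_cvgn.
  by apply: nondecreasing_series => n _ _; exact: powR_ge0.
pose c := p - 1; have c0 : 0 < c by rewrite subr_gt0.
exists (1 + c^-1) => _ [n _ <-]; rewrite /series/=.
suff : \sum_(0 <= k < n.+1) (k.+1%:R `^ (- p) : R) <=
    1 + c^-1 * (1 - n.+1%:R `^ (- c)).
  rewrite big_nat_recr//= => h.
  have h1 := powR_ge0 (n.+1%:R : R) (- p).
  have h2 : 0 <= c^-1 * n.+1%:R `^ (- c).
    by rewrite mulr_ge0 ?invr_ge0 ?powR_ge0 ?ltW.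
  by move: h; rewrite mulrBr; lra.
elim: n => [|n IH].
  by rewrite big_nat1 powR1 subrr mulr0 addr0.
rewrite big_nat_recr//=.
have := @powR_decrement c n.+1%:R c0 (ltr0Sn _ _).
rewrite natr1 -ler_pdivlMl// subrK.
move: IH; rewrite !mulrBr; lra.
Qed.

Lemma esum_zeta (p : R) : 1 < p ->
  \esum_(n in [set: nat]) (n.+1%:R `^ (- p))%:E = (zeta p)%:E.
Proof.
move=> p1; apply: esum_series; last exact: is_cvg_zeta.
by move=> n; exact: powR_ge0.
Qed.

End Series.

(** * Binary words, sorted by length *)

Section Words.

Fixpoint words (k : nat) : seq (seq bool) :=
  if k is k'.+1 then map (cons true) (words k') ++ map (cons false) (words k')
  else [:: [::]].

Lemma mem_words k w : (w \in words k) = (size w == k).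
Proof.
elim: k w => [|k IH] w /=; first by rewrite inE size_eq0.
have memc b v b' : (b :: v \in map (cons b') (words k)) =
    (b == b') && (size v == k).
  have [<-|bb'] := eqVneq b b'; first by rewrite mem_map ?IH// => ? ? [].
  by apply/negP => /mapP[v' _ []] /eqP; rewrite (negPf bb').
rewrite mem_cat; case: w => [|b w]; last first.
  by rewrite !memc /= eqSS; case: b; rewrite ?orbF.
by apply/negbTE/norP; split; apply/negP => /mapP[].
Qed.

Lemma uniq_words k : uniq (words k).
Proof.
elim: k => //= k IH; rewrite cat_uniq !map_inj_uniq ?IH/=; try by move=> ? ? [].
by rewrite andbT; apply/hasP => -[_ /mapP[v _ ->]] /mapP[v' _].
Qed.

Lemma esum_words (R : realType) (a : seq bool -> \bar R) : (forall w, (0 <= a w)%E) ->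
  \esum_(w in [set: seq bool]) a w =
  \esum_(k in [set: nat]) (\sum_(w <- words k) a w)%E.
Proof.
move=> a0; have -> : [set: seq bool] = \bigcup_(k in [set: nat]) [set` words k].
  by apply/seteqP; split => // w _; exists (size w) => //=; rewrite mem_words.
rewrite esum_bigcupT//; last first.
  move=> i j _ _ [w [/=]]; rewrite !mem_words.
  by move=> /eqP -> /eqP.
apply: eq_esum => k _; rewrite esum_fset//; last exact: finite_seq.
by rewrite (fsbig_seq _ _ (uniq_words k)).
Qed.

End Words.

(** * The tree generated from a pair, and the sum of the weights over it *)

Section Tree.

Definition cross (p : (int * int) * (int * int)) : int :=
  p.1.1 * p.2.2 - p.2.1 * p.1.2.

Definition step (b : bool) (p : (int * int) * (int * int)) :=
  if b then (p.1, p.1 + p.2) else (p.1 + p.2, p.2).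

(** With [foldr] the head letter is the last step applied, so the words of length k + 1 give the
    children of the nodes at level k. *)
Definition act (w : seq bool) (p : (int * int) * (int * int)) :=
  foldr step p w.

Definition mpos (p : (int * int) * (int * int)) :=
  (0 < p.1.1) && (0 < p.2.1).

Lemma cross_step b p : cross (step b p) = cross p.
Proof. by case: p b => [[a b] [c d]] [] /=; rewrite /cross/=; ring. Qed.

Lemma cross_act w p : cross (act w p) = cross p.
Proof. by elim: w => //= b w IH; rewrite cross_step. Qed.

Lemma mpos_step b p : mpos p -> mpos (step b p).
Proof. by case: p b => [[a b] [c d]] [] /=; rewrite /mpos/=; lia. Qed.

Lemma mpos_act w p : mpos p -> mpos (act w p).
Proof. by move=> p0; elim: w => //= b w; exact: mpos_step. Qed.

(** Each step adds one positive first coordinate to the other, which raises their product by at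
    least 1. *)
Lemma size_lt_act w p : mpos p ->
  (size w)%:Z < (act w p).1.1 * (act w p).2.1.
Proof.
move=> p0; elim: w => [|b w IH] /=; first by move: p0; rewrite /mpos; nia.
move: IH (mpos_act w p0); rewrite /mpos.
by case: (act w p) b => [[a b] [c d]] [] /=; nia.
Qed.

Variables (R : realType) (x y : R).
Hypothesis y0 : 0 < y.

Definition qform (u : int * int) : R :=
  (u.1%:~R * x + u.2%:~R) ^+ 2 + (u.1%:~R * y) ^+ 2.

Definition bform (u v : int * int) : R :=
  (u.1%:~R * x + u.2%:~R) * (v.1%:~R * x + v.2%:~R) +
  (u.1%:~R * y) * (v.1%:~R * y).

Definition cot (p : (int * int) * (int * int)) : R :=
  bform p.1 p.2 / ((cross p)%:~R * y).

Definition wt (p : (int * int) * (int * int)) : R :=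
  (qform p.1 * qform p.2 * qform (p.1 + p.2))^-1.

Lemma qform_ge0 u : 0 <= qform u.
Proof. by rewrite addr_ge0// sqr_ge0. Qed.

Lemma qform_gt0 u : u != 0 -> 0 < qform u.
Proof.
case: u => m n u0; rewrite lt_def qform_ge0 andbT /qform/=.
apply: contra u0; rewrite paddr_eq0 ?sqr_ge0// !sqrf_eq0 mulf_eq0 (gt_eqF y0) orbF.
rewrite intr_eq0 => /andP[+ /eqP m0].
by rewrite m0 mulr0z mul0r add0r intr_eq0 => /eqP ->.
Qed.

Lemma qformD u v : qform (u + v) = qform u + qform v + 2 * bform u v.
Proof. by rewrite /qform /bform/= !intrD; ring. Qed.

(** Lagrange's identity for two plane vectors, whose determinant is y times [cross] up to sign. *)
Lemma qformM p : qform p.1 * qform p.2 =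
  bform p.1 p.2 ^+ 2 + ((cross p)%:~R * y) ^+ 2.
Proof. by rewrite /qform /bform /cross intrB !intrM; ring. Qed.

Lemma bformDr u v : bform u (u + v) = qform u + bform u v.
Proof. by rewrite /qform /bform/= !intrD; ring. Qed.

Lemma bformDl u v : bform (u + v) v = qform v + bform u v.
Proof. by rewrite /qform /bform/= !intrD; ring. Qed.

Lemma cross_neq0 p : cross p != 0 -> [/\ p.1 != 0, p.2 != 0 & p.1 + p.2 != 0].
Proof.
case: p => [[a b] [c d]]; rewrite /cross/= => h; split;
  by apply: contra_neq h => -[]; nia.
Qed.

Lemma wt_ge0 p : 0 <= wt p.
Proof. by rewrite invr_ge0 !mulr_ge0// qform_ge0. Qed.

Lemma segment_area_cot p : 0 < cross p ->
  segment_area (cot p) = segment_area (cot (step true p)) +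
    segment_area (cot (step false p)) + 4 * ((cross p)%:~R * y) ^+ 3 * wt p.
Proof.
move=> c0; have d0 : 0 < (cross p)%:~R * y by rewrite mulr_gt0// ltr0z.
have [|/qform_gt0 q1 /qform_gt0 q2 _] := @cross_neq0 p; first by rewrite gt_eqF.
have := segment_area_split q1 q2 d0 (qformM p).
rewrite /cot !cross_step /= bformDr bformDl /wt qformD => <-; ring.
Qed.

(** The vector u + v lies between u and v, so the angle shrinks and its cotangent grows. *)
Lemma cot_step b p : 0 < cross p -> cot p <= cot (step b p).
Proof.
move=> c0; rewrite /cot cross_step.
rewrite ler_pM2r ?invr_gt0 ?mulr_gt0 ?ltr0z//.
by case: b => /=; rewrite ?bformDr ?bformDl lerDr qform_ge0.
Qed.

Lemma cot_act w p : 0 < cross p -> cot p <= cot (act w p).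
Proof.
move=> c0; elim: w => //= b w IH; apply: (le_trans IH).
by apply: cot_step; rewrite cross_act.
Qed.

(** By 1/(m n) = 1/(m (m + n)) + 1/((m + n) n), each node passes its mass 1/(m n) on to its two
    children, so every level carries the same total. *)
Lemma sum_words_invM k p : mpos p ->
  \sum_(w <- words k) (((act w p).1.1)%:~R * ((act w p).2.1)%:~R)^-1 =
  (p.1.1%:~R * p.2.1%:~R)^-1 :> R.
Proof.
move=> p0; elim: k => [|k IH] /=; first by rewrite big_seq1.
rewrite big_cat/= !big_map -big_split/= -IH; apply: eq_bigr => w _ /=.
have := mpos_act w p0; case: (act w p) => [[a b] [c d]] /=.
rewrite /mpos/= => /andP[a0 c0].
have a0' : 0 < a%:~R :> R by rewrite ltr0z.
have c0' : 0 < c%:~R :> R by rewrite ltr0z.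
by rewrite intrD; field; rewrite !gt_eqF ?addr_gt0.
Qed.

Definition level_area p k : R := \sum_(w <- words k) segment_area (cot (act w p)).

Lemma level_areaS p k : 0 < cross p -> level_area p k = level_area p k.+1 +
  4 * ((cross p)%:~R * y) ^+ 3 * \sum_(w <- words k) wt (act w p).
Proof.
move=> c0; rewrite /level_area /= big_cat/= !big_map -big_split/= big_distrr/=.
rewrite -big_split/=; apply: eq_bigr => w _.
by rewrite segment_area_cot ?cross_act.
Qed.

(** Along the tree [cot] stays above its root value, so the quadratic bound on E applies with one
    constant. There 1 + cot^2 = Q(u) Q(v) / d^2 >= y^4 (m n)^2 / d^2; one factor m n is kept as
    conserved mass, the other is at least the level plus 1. *)
Lemma segment_area_act_le p : 0 < cross p -> mpos p -> exists C : R, forall w,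
  segment_area (cot (act w p)) <=
  C / (size w).+1%:R * (((act w p).1.1)%:~R * ((act w p).2.1)%:~R)^-1.
Proof.
move=> c0 p0; have [C C0 HC] := segment_area_bound (cot p).
pose d : R := (cross p)%:~R * y.
have d0 : 0 < d by rewrite mulr_gt0// ltr0z.
exists (C * d ^+ 2 / y ^+ 4) => w.
apply: (le_trans (HC _ (cot_act w c0))).
have := size_lt_act w p0; have := mpos_act w p0.
have := qformM (act w p); rewrite /cot cross_act -/d.
move: (act w p) => q qq /andP[]; rewrite -lezD1 (addrC _ 1) -intS.
set m : R := q.1.1%:~R; set n : R := q.2.1%:~R => m0 n0.
rewrite -(ler_int R) intrM -/m -/n => mn.
have {}m0 : 0 < m by rewrite ltr0z.
have {}n0 : 0 < n by rewrite ltr0z.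
have mn0 : 0 < m * n by rewrite mulr_gt0.
set k : R := (size w).+1%:R in mn *; have k0 : 0 < k by rewrite ltr0Sn.
have -> : C / (1 + (bform q.1 q.2 / d) ^+ 2) =
    C * d ^+ 2 * (qform q.1 * qform q.2)^-1.
  by rewrite qq; field; rewrite !gt_eqF ?ltr_pwDr ?sqr_ge0 ?exprn_gt0.
have -> : C * d ^+ 2 / y ^+ 4 / k * (m * n)^-1 =
    C * d ^+ 2 * (y ^+ 4 * (m * n) * k)^-1 by field; rewrite !gt_eqF.
rewrite ler_wpM2l ?(mulr_ge0 C0) ?sqr_ge0//.
rewrite lef_pV2 ?posrE; last 2 first.
- by rewrite qq ltr_pwDr ?sqr_ge0 ?exprn_gt0.
- by rewrite !mulr_gt0 ?exprn_gt0.
apply: (@le_trans _ _ ((m * y) ^+ 2 * (n * y) ^+ 2)).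
  have -> : (m * y) ^+ 2 * (n * y) ^+ 2 = y ^+ 4 * (m * n) * (m * n) by ring.
  by rewrite ler_pM2l// !mulr_gt0 ?exprn_gt0.
by apply: ler_pM; rewrite ?sqr_ge0// lerDr sqr_ge0.
Qed.

(** Summing the previous bound over level k gives a constant multiple of the conserved mass divided
    by k + 1. *)
Lemma cvg_level_area p : 0 < cross p -> mpos p -> level_area p @ \oo --> (0 : R).
Proof.
move=> c0 p0; have [C HC] := segment_area_act_le c0 p0.
pose M : R := (p.1.1%:~R * p.2.1%:~R)^-1.
apply: (@squeeze_cvgr _ _ _ _ (fun=> 0) (fun k => C * M * k.+1%:R^-1)).
- apply: nearW => k; rewrite sumr_ge0/=; last by move=> w _; exact: segment_area_ge0.
  rewrite /M -(sum_words_invM k p0) mulrAC big_distrr/= /level_area.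
  rewrite big_seq [leRHS]big_seq; apply: ler_sum => w.
  by rewrite mem_words => /eqP <-; exact: HC.
- exact: cvg_cst.
- have -> : (0 : R) = C * M * 0 by rewrite mulr0.
  by apply: cvgM; [exact: cvg_cst|exact: cvg_harmonic].
Qed.

Lemma esum_act (K : R) p : 0 <= K -> 0 < cross p -> mpos p ->
  \esum_(w in [set: seq bool]) (K * wt (act w p))%:E =
  (K * (segment_area (cot p) / (4 * ((cross p)%:~R * y) ^+ 3)))%:E.
Proof.
move=> K0 c0 p0.
have d0 : 0 < (cross p)%:~R * y by rewrite mulr_gt0// ltr0z.
have D0 : 0 < 4 * ((cross p)%:~R * y) ^+ 3 by rewrite mulr_gt0// exprn_gt0.
set D := 4 * _ in D0 *.
rewrite esum_words => [|w]; last by rewrite lee_fin mulr_ge0// wt_ge0.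
(* The weights of level k are the drop of [u] from k to k + 1, so the sum over all levels is [u 0],
   the contribution of the root. *)
pose u k := K / D * level_area p k.
have uE k : (\sum_(w <- words k) (K * wt (act w p))%:E)%E = (u k - u k.+1)%:E.
  rewrite sumEFin -big_distrr/=; congr _%:E.
  by rewrite /u [level_area p k]level_areaS// -/D; field; rewrite gt_eqF.
under eq_esum do rewrite uE.
rewrite (esum_telescope (l := 0)).
- by rewrite /u /level_area/= big_seq1/=; congr _%:E; field; rewrite gt_eqF.
- move=> k; rewrite -subr_ge0 -lee_fin -uE sumEFin lee_fin sumr_ge0// => w _.
  by rewrite mulr_ge0// wt_ge0.
- rewrite -[X in _ --> X](mulr0 (K / D)).
  by apply: cvgM; [exact: cvg_cst|exact: cvg_level_area].
Qed.

End Tree.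

(** * Roots of the trees, and unique representation of pairs by Euclid's algorithm *)

Section Roots.

(** An index (a, e, b) stands for the positive integers a + 1 and e + 1, so the index set is a full
    product. *)
Definition axis_pair (i : nat * nat * int) : (int * int) * (int * int) :=
  ((i.1.1.+1%:Z, i.2), (0, i.1.2.+1%:Z)).

(** One child of an axis pair. The other child is again an axis pair, with b increased by the second
    positive integer; this drives the telescoping in b. *)
Definition diag_pair (i : nat * nat * int) : (int * int) * (int * int) :=
  step true (axis_pair i).

Lemma cross_axis_pair i : cross (axis_pair i) = i.1.1.+1%:Z * i.1.2.+1%:Z.
Proof. by rewrite /cross/= mul0r subr0. Qed.

Lemma cross_diag_pair i : cross (diag_pair i) = i.1.1.+1%:Z * i.1.2.+1%:Z.
Proof. by rewrite cross_step cross_axis_pair. Qed.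

Lemma mpos_diag_pair i : mpos (diag_pair i).
Proof. by rewrite /mpos/= addr0 ltz_nat. Qed.

Lemma diag_pair_inj : injective diag_pair.
Proof.
move=> [[a e] b] [[a' e'] b'] h.
have ha := congr1 (fun p => p.1.1) h; have hb := congr1 (fun p => p.1.2) h.
have he := congr1 (fun p => p.2.2) h; rewrite /= in ha hb he.
by congr (_, _, _); lia.
Qed.

Lemma axis_pair_inj : injective axis_pair.
Proof. by move=> [[a e] b] [[a' e'] b'] [-> -> ->]. Qed.

Lemma step_inj b : injective (step b).
Proof.
move=> [u v] [u' v']; case: b => /pair_equal_spec/= [].
  by move=> -> /addrI ->.
by move=> uv vv'; move: uv; rewrite vv' => /addIr ->.
Qed.

Lemma step_lt b p : mpos p -> ((step b p).1.1 < (step b p).2.1) = b.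
Proof. by case: p => [[a c] [a' c']]; case: b; rewrite /mpos/=; lia. Qed.

Lemma step_neq b p : mpos p -> (step b p).1.1 <> (step b p).2.1.
Proof. by case: p => [[a c] [a' c']]; case: b; rewrite /mpos/=; lia. Qed.

(** The order of the two first coordinates reveals the last step, and they are equal only at a root;
    hence a node determines its word and its root. *)
Lemma act_diag_pair_inj w w' i j :
  act w (diag_pair i) = act w' (diag_pair j) -> w = w' /\ i = j.
Proof.
elim: w w' => [|b w IH] [|b' w'] //=.
- by move=> /diag_pair_inj.
- move=> e; have := step_neq (b := b') (mpos_act w' (mpos_diag_pair j)).
  by rewrite -e /= addr0.
- move=> e; have := step_neq (b := b) (mpos_act w (mpos_diag_pair i)).
  by rewrite e /= addr0.
- move=> e; have := step_lt b (mpos_act w (mpos_diag_pair i)).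
  rewrite e step_lt; last exact/mpos_act/mpos_diag_pair.
  by move=> bb'; rewrite -bb' in e *; have [-> ->] := IH _ (step_inj e).
Qed.

(* Euclid's algorithm on the first coordinates, stopped when they agree. *)
Lemma mpos_act_diag_pair p : mpos p -> 0 < cross p ->
  exists i w, p = act w (diag_pair i).
Proof.
have pairD (a b c d : int) : (a, b) + (c, d) = (a + c, b + d) by [].
have [n] := ubnP (absz (p.1.1 + p.2.1)); elim: n p => // n IH.
move=> [[m b] [m' b']] /= nlt p0 c0.
have [mm'|mm'|mm'] := ltgtP m m'.
- have [||| i [w e]] := IH ((m, b), (m' - m, b' - b)).
  + by move: p0; rewrite /mpos /=; lia.
  + by move: p0; rewrite /mpos /=; lia.
  + by move: c0; rewrite /cross/=; lia.
  by exists i, (true :: w); rewrite /= -e /step/= pairD; congr ((_, _), (_, _)); lia.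
- have [||| i [w e]] := IH ((m - m', b - b'), (m', b')).
  + by move: p0; rewrite /mpos /=; lia.
  + by move: p0; rewrite /mpos /=; lia.
  + by move: c0; rewrite /cross/=; lia.
  by exists i, (false :: w); rewrite /= -e /step/= pairD; congr ((_, _), (_, _)); lia.
- move: p0 c0; rewrite -mm' /mpos /cross/= => /andP[m0 _] c0.
  have bb' : b < b' by nia.
  exists ((absz m).-1, (absz (b' - b)).-1, b), [::] => /=.
  by rewrite /diag_pair /= /step /axis_pair /= pairD; congr ((_, _), (_, _)) => /=; lia.
Qed.

End Roots.

(** * Reduction to the fundamental cone by the symmetries of order 2 and 6 *)

Section Symmetry.

Definition swap (p : (int * int) * (int * int)) := (p.2, p.1).

(** On triples (u, v, w) with sum 0 this is (-v, -w, -u), a cyclic shift combined with negation. *)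
Definition rot (p : (int * int) * (int * int)) := (- p.2, p.1 + p.2).

Definition rot_inv (p : (int * int) * (int * int)) := (p.1 + p.2, - p.1).

Definition fund (p : (int * int) * (int * int)) :=
  (0 < p.1.1) && (0 <= p.2.1).

Lemma rotK : cancel rot rot_inv.
Proof. by move=> [u v]; rewrite /rot /rot_inv /= addrCA addNr addr0 opprK. Qed.

Lemma rot_invK : cancel rot_inv rot.
Proof. by move=> [u v]; rewrite /rot /rot_inv /= opprK addrAC subrr add0r. Qed.

Lemma cross_rot p : cross (rot p) = cross p.
Proof. by case: p => [[a b] [c d]]; rewrite /cross/=; ring. Qed.

Lemma cross_swap p : cross (swap p) = - cross p.
Proof. by case: p => [[a b] [c d]]; rewrite /cross/=; ring. Qed.

(* [rot] has order 6 and the six translates of the half-open cone [fund] tile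
   the punctured plane of first coordinates. *)
Lemma fund_rot_tiling p : cross p != 0 ->
  (\sum_(k < 6) fund (iter k rot p) = 1)%N.
Proof.
case: p => [[a b] [c d]]; rewrite /cross/= => h.
have : (a != 0) || (c != 0).
  apply: contraNT h; rewrite negb_or !negbK => /andP[/eqP -> /eqP ->].
  by rewrite !mul0r subrr.
rewrite !big_ord_recl big_ord0 /fund /=; lia.
Qed.

Variable (R : realType).
Implicit Type F : (int * int) * (int * int) -> \bar R.

Lemma esum_swap F : (forall p, (0 <= F p)%E) -> (forall p, F (swap p) = F p) ->
  \esum_(p in [set p | cross p != 0]) F p =
  (2%:R%:E * \esum_(p in [set p | (0 < cross p)%R]) F p)%E.
Proof.
move=> F0 Fs; rewrite (esumID [set p | 0 < cross p])//.
have -> : [set p | cross p != 0] `&` [set p | 0 < cross p] = [set p | 0 < cross p].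
  by apply/seteqP; split => p /=; lia.
rewrite mule_natl mule2n; congr adde.
rewrite (reindex_esum [set p | 0 < cross p] _ swap); last first.
  split => [p /=|p q _ _|p /= p0].
  - by rewrite cross_swap; lia.
  - by case: p q => [u v] [u' v'] [-> ->].
  - by exists (swap p) => //=; [rewrite cross_swap; lia|case: p p0].
by apply: eq_esum => p _.
Qed.

(** Cut off to [fund], F becomes G. By the tiling F is the sum of the six translates of G, which all
    have the same sum since [rot] permutes the pairs with positive [cross]. *)
Lemma esum_rot F : (forall p, (0 <= F p)%E) -> (forall p, F (rot p) = F p) ->
  \esum_(p in [set p | 0 < cross p]) F p =
  (6%:R%:E * \esum_(p in [set p | (0 < cross p)%R /\ fund p]) F p)%E.
Proof.
move=> F0 Fr; pose G p := if fund p then F p else 0%E.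
have G0 p : (0 <= G p)%E by rewrite /G; case: ifP.
have GE : \esum_(p in [set p | 0 < cross p /\ fund p]) F p =
    \esum_(p in [set p | 0 < cross p]) G p.
  rewrite (_ : [set p | _ /\ _] = [set p | 0 < cross p] `&` [set p | fund p])//.
  by rewrite esum_mkcondr; apply: eq_esum => p _; rewrite /G mem_setE.
have Gr k : \esum_(p in [set p | 0 < cross p]) G (iter k rot p) =
    \esum_(p in [set p | 0 < cross p]) G p.
  elim: k => // k IH; rewrite -[RHS]IH.
  rewrite [RHS](reindex_esum [set p | 0 < cross p] _ rot); last first.
    split => [p /=|p q _ _|p /= p0]; rewrite ?cross_rot//.
      exact: (can_inj rotK).
    by exists (rot_inv p); [rewrite /= -cross_rot|]; rewrite rot_invK.
  by apply: eq_esum => p _; rewrite -iterSr.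
transitivity (\esum_(p in [set p | 0 < cross p]) (\sum_(k < 6) G (iter k rot p))%E).
  apply: eq_esum => p /= p0.
  have Fk k : F (iter k rot p) = F p by elim: k => //= k <-.
  have := @fund_rot_tiling p; rewrite gt_eqF// => /(_ isT).
  rewrite /G !big_ord_recl !big_ord0 !Fk.
  by do 6![case: (fund _)] => //= _; rewrite ?adde0 ?add0e.
rewrite esum_sum//; under eq_bigr do rewrite Gr.
by rewrite sumr_const card_ord GE mule_natl.
Qed.

(** The pairs of the cone with m_2 = 0 are the axis pairs; those with m_2 > 0 are the nodes of the
    trees, each met once. *)
Lemma esum_fund F : (forall p, (0 <= F p)%E) ->
  \esum_(p in [set p | 0 < cross p /\ fund p]) F p =
  \esum_(i in [set: nat * nat * int])
    (F (axis_pair i) + \esum_(w in [set: seq bool]) F (act w (diag_pair i)))%E.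
Proof.
move=> F0; rewrite (esumID [set p | p.2.1 == 0])//.
rewrite esumD//; last by move=> i _; apply: esum_ge0.
congr adde.
  apply: reindex_esum; split => [i _|i j _ _|p].
  - by rewrite /= cross_axis_pair /fund/=; split; [split|]; lia.
  - exact: axis_pair_inj.
  - case: p => [[a b] [c d]] /=; rewrite /cross /fund /= => -[[+ /andP[a0 _]] /eqP c0].
    rewrite c0 mul0r subr0 => ad.
    exists ((absz a).-1, (absz d).-1, b) => //.
    by rewrite /axis_pair/=; congr ((_, _), (_, _)); nia.
rewrite esum_esum// (_ : _ `*`` _ = [set: _ * _]); last by apply/seteqP; split.
apply: reindex_esum; split => [[i w] _|[i w] [j w'] _ _ /=|p].
- rewrite /= cross_act cross_diag_pair.
  have := mpos_act w (mpos_diag_pair i); rewrite /mpos /fund => /andP[m0 m0'].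
  by split; [split|]; lia.
- by move=> /act_diag_pair_inj[-> ->].
- move=> [[c0 /andP[m0 m0']] /= m1]; have [||i [w e]] := @mpos_act_diag_pair p.
  + by rewrite /mpos; lia.
  + exact: c0.
  by exists (i, w).
Qed.

End Symmetry.

(** * Telescoping sums over the integers *)

Section Integers.
Variable R : realType.

Lemma esum_int_telescope (f : int -> R) (lN lP : R) :
  (forall b, f (b + 1) <= f b) ->
  f n%:Z @[n --> \oo] --> lP -> f (- n%:Z) @[n --> \oo] --> lN ->
  \esum_(b in [set: int]) (f b - f (b + 1))%:E = (lN - lP)%:E.
Proof.
move=> df fP fN; rewrite (esumID [set b | 0 <= b]); last first.
  by move=> b _; rewrite lee_fin subr_ge0.
rewrite (reindex_esum [set: nat] _ Posz); last first.
  split => [n //=|m n _ _ [->]//|b /= [_ b0]].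
  by exists (absz b) => //; lia.
rewrite (reindex_esum [set: nat] (_ `&` ~` _) Negz); last first.
  split => [n //=|m n _ _ [->]//|b /= [_ b0]].
  by exists (absz b).-1 => //; lia.
have -> : \esum_(n in [set: nat]) (f n%:Z - f (n%:Z + 1))%:E = (f 0 - lP)%:E.
  rewrite -(esum_telescope (u := fun n => f n%:Z) _ fP) => [|n].
    by apply: eq_esum => n _; rewrite intS (addrC 1).
  by rewrite intS (addrC 1).
(* As [Negz n] is -(n + 1), these are the successive decrements of n |-> - f (- n). *)
have -> : \esum_(n in [set: nat]) (f (Negz n) - f (Negz n + 1))%:E = (lN - f 0)%:E.
  have NS (n : nat) : - n.+1%:Z + 1 = - n%:Z by rewrite intS opprD addrAC addNr add0r.
  have fN' : - f (- n%:Z) @[n --> \oo] --> - lN by exact: cvgN.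
  have -> : lN - f 0 = - f (- 0%:Z) - - lN by rewrite oppr0 opprK addrC.
  rewrite -(esum_telescope (u := fun n => - f (- n%:Z)) _ fN') => [|n].
    by apply: eq_esum => n _; rewrite NegzE NS opprK addrC.
  by rewrite lerN2 -NS.
by rewrite -EFinD; congr _%:E; ring.
Qed.

(** A jump by e is a sum of e unit jumps; translation of b shows that each of them contributes lN -
    lP. *)
Lemma esum_int_telescope_step (f : int -> R) (lN lP : R) (e : nat) :
  (forall b, f (b + 1) <= f b) ->
  f n%:Z @[n --> \oo] --> lP -> f (- n%:Z) @[n --> \oo] --> lN ->
  \esum_(b in [set: int]) (f b - f (b + e%:Z))%:E = (e%:R * (lN - lP))%:E.
Proof.
move=> df fP fN; have dfn b n : f (b + n%:Z) <= f b.
  elim: n => [|n]; first by rewrite addr0.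
  by apply: le_trans; rewrite intS (addrC 1) addrA.
elim: e => [|e IH].
  by rewrite mul0r esum1// => b _; rewrite addr0 subrr.
transitivity (\esum_(b in [set: int]) ((f b - f (b + e%:Z))%:E +
   (f (b + e%:Z) - f (b + e%:Z + 1))%:E))%E.
  by apply: eq_esum => b _; rewrite -EFinD intS (addrC 1) addrA; congr _%:E; ring.
rewrite esumD; [|by move=> b _; rewrite lee_fin subr_ge0..].
rewrite IH -(reindex_esum [set: int] [set: int] (fun b => b + e%:Z)
  (fun b => (f b - f (b + 1))%:E)); last first.
  split => // [m n _ _ /addIr//|b _]; exists (b - e%:Z) => //.
  by rewrite subrK.
rewrite (esum_int_telescope df fP fN) -EFinD; congr _%:E.
by rewrite -natr1; ring.
Qed.

End Integers.

(** * Evaluation of the sum over pairs of integer vectors *)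

Section LatticeSum.
Variables (R : realType) (x y : R).
Hypothesis y0 : 0 < y.

Lemma cvg_segment_area_affine (k c : R) : 0 < c ->
  segment_area ((n%:R + k) / c) @[n --> \oo] --> (0 : R).
Proof.
move=> c0; apply: (cvg_comp _ _ _ (@cvgy_segment_area R)).
apply/cvgryPge => A; near=> n.
rewrite ler_pdivlMr// -lerBlDr; near: n; exact: nbhs_infty_ger.
Unshelve. all: by end_near. Qed.

Lemma cot_axis_pair a e b : cot x y (axis_pair (a, e, b)) =
  (b%:~R + a.+1%:R * x) / (a.+1%:R * y).
Proof.
rewrite /cot cross_axis_pair /bform/= intrM mulr0z -!pmulrn; field.
by rewrite gt_eqF// !nat1r !pnatr_eq0.
Qed.

Lemma esum_segment_area_axis (a e : nat) :
  \esum_(b in [set: int]) (segment_area (cot x y (axis_pair (a, e, b))) -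
     segment_area (cot x y (axis_pair (a, e, b + e.+1%:Z))))%:E =
  (e.+1%:R * (2 * pi))%:E.
Proof.
have ay0 : 0 < a.+1%:R * y by rewrite mulr_gt0// ltr0Sn.
rewrite (@esum_int_telescope_step R
  (fun b => segment_area (cot x y (axis_pair (a, e, b)))) (2 * pi) 0) ?subr0//.
- move=> b; apply: segment_area_nonincreasing; rewrite !cot_axis_pair.
  by rewrite ler_pM2r ?invr_gt0// lerD2r ler_int lerDl.
- under eq_cvg do rewrite cot_axis_pair -pmulrn.
  exact: cvg_segment_area_affine.
- rewrite -[X in _ --> X]subr0.
  have fE n : segment_area (cot x y (axis_pair (a, e, - n%:Z))) =
      2 * pi - segment_area ((n%:R + - (a.+1%:R * x)) / (a.+1%:R * y)).
    rewrite -segment_areaN cot_axis_pair intrN -pmulrn -mulNr.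
    by congr (segment_area (_ / _)); ring.
  under eq_cvg do rewrite fE.
  by apply: cvgB; [exact: cvg_cst|exact: cvg_segment_area_affine].
Qed.

Lemma wt_swap p : wt x y (swap p) = wt x y p.
Proof. by rewrite /wt/= addrC (mulrC (qform x y p.2)). Qed.

Lemma wt_rot p : wt x y (rot p) = wt x y p.
Proof.
have qN u : qform x y (- u) = qform x y u by rewrite /qform/= !mulrNz; ring.
by rewrite /wt/= qN (addrC (- _)) addrK; congr _^-1; ring.
Qed.

(** The tree yields E at the [step true] child, so by the splitting identity at the axis pair only E
    at the axis pair minus E at its [step false] child, the axis pair shifted in b, survives. *)
Lemma wt_axis_diag (K : R) a e b : 0 <= K ->
  let d := (a.+1%:R * e.+1%:R) * y in
  ((K * wt x y (axis_pair (a, e, b)))%:E +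
   \esum_(w in [set: seq bool]) (K * wt x y (act w (diag_pair (a, e, b))))%:E)%E
  = (K / (4 * d ^+ 3) * (segment_area (cot x y (axis_pair (a, e, b))) -
     segment_area (cot x y (axis_pair (a, e, b + e.+1%:Z)))))%:E.
Proof.
move=> K0 d.
have d0 : 0 < d by rewrite !mulr_gt0 ?ltr0Sn.
have c0 : 0 < cross (axis_pair (a, e, b)) by rewrite cross_axis_pair; lia.
rewrite (esum_act _ y0 K0 _ (mpos_diag_pair _)); last by rewrite cross_step.
rewrite (segment_area_cot x y0 c0).
have -> : step false (axis_pair (a, e, b)) = axis_pair (a, e, b + e.+1%:Z).
  by rewrite /step /axis_pair/=; congr ((_, _), _); rewrite addr0.
rewrite cross_diag_pair cross_axis_pair /= intrM -!pmulrn -/d -EFinD.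
by congr _%:E; rewrite /diag_pair; field; rewrite gt_eqF.
Qed.

Lemma esum_cross (s : R) : -1 < s ->
  \esum_(p in [set p | cross p != 0])
    (`|(cross p)%:~R| `^ (- s) * wt x y p)%:E =
  (6 * pi / y ^+ 3 * zeta (s + 3) * zeta (s + 2))%:E.
Proof.
move=> s1; set F := fun p => (_ * wt x y p)%:E.
have F0 p : (0 <= F p)%E by rewrite lee_fin mulr_ge0 ?powR_ge0// wt_ge0.
rewrite esum_swap//; last first.
  by move=> p; rewrite /F wt_swap cross_swap mulrNz normrN.
rewrite esum_rot//; last by move=> p; rewrite /F wt_rot cross_rot.
rewrite esum_fund//.
(* From (a e)^-s 2 pi e / (4 (a e y)^3) = c a^-(s+3) e^-(s+2). The multiplicity 12 turns c into 6 pi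
   / y^3. *)
pose c : R := pi / (2 * y ^+ 3).
have c0 : 0 <= c by rewrite divr_ge0 ?pi_ge0// mulr_ge0// exprn_ge0// ltW.
have -> : \esum_(i in [set: nat * nat * int]) (F (axis_pair i) +
    \esum_(w in [set: seq bool]) F (act w (diag_pair i)))%E =
  \esum_(i in [set: nat * nat])
    (c * (i.1.+1%:R `^ (- (s + 3)) * i.2.+1%:R `^ (- (s + 2))))%:E.
  pose G (i : nat * nat) b : \bar R := (F (axis_pair (i, b)) +
    \esum_(w in [set: seq bool]) F (act w (diag_pair (i, b))))%E.
  have G0 i b : (0 <= G i b)%E by rewrite adde_ge0//; exact: esum_ge0.
  transitivity (\esum_(i in [set: nat * nat]) \esum_(b in [set: int]) G i b).
    rewrite esum_esum// (_ : _ `*`` _ = [set: _ * _]); last by apply/seteqP; split.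
    by apply: eq_esum => -[i b] _.
  apply: eq_esum => -[a e] _ /=.
  pose K : R := (a.+1%:R * e.+1%:R) `^ (- s).
  have K0 : 0 <= K by exact: powR_ge0.
  (* The power of the determinant is constant on the axis pair and its tree, as steps preserve
     [cross]. *)
  have KE p : cross p = a.+1%:Z * e.+1%:Z -> F p = (K * wt x y p)%:E.
    by move=> pE; rewrite /F pE intrM -!pmulrn ger0_norm// mulr_ge0.
  have GE b : G (a, e) b = (K / (4 * ((a.+1%:R * e.+1%:R) * y) ^+ 3) *
     (segment_area (cot x y (axis_pair (a, e, b))) -
      segment_area (cot x y (axis_pair (a, e, b + e.+1%:Z)))))%:E.
    rewrite -(wt_axis_diag a e b K0) /G (KE _ (cross_axis_pair (a, e, b))); congr adde.
    by apply: eq_esum => w _; rewrite KE// cross_act cross_diag_pair.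
  under eq_esum do rewrite GE EFinM.
  have a0 : (a.+1%:R : R) != 0 by rewrite pnatr_eq0.
  have e0 : (e.+1%:R : R) != 0 by rewrite pnatr_eq0.
  rewrite esumZl; last 2 first.
  - by rewrite divr_ge0// mulr_ge0// exprn_ge0// !mulr_ge0// ltW.
  - move=> b; rewrite lee_fin subr_ge0; apply: segment_area_nonincreasing.
    rewrite !cot_axis_pair ler_pM2r ?invr_gt0 ?mulr_gt0 ?ltr0Sn//.
    by rewrite lerD2r ler_int lerDl.
  rewrite esum_segment_area_axis -EFinM; congr _%:E.
  have powB (t : R) (k : nat) : t != 0 -> 0 <= t ->
      t `^ (- (s + k%:R)) = t `^ (- s) / t ^+ k.
    move=> t0 t0'; rewrite opprD powRD ?t0 ?implybT//.
    by rewrite powR_invn.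
  rewrite !powB// /K powRM// /c; field.
  by rewrite !nat1r a0 e0 gt_eqF.
have z3 : 1 < s + 3 by lra.
(* This is exactly the hypothesis on s. *)
have z2 : 1 < s + 2 by lra.
have -> : \esum_(i in [set: nat * nat])
    (c * (i.1.+1%:R `^ (- (s + 3)) * i.2.+1%:R `^ (- (s + 2))))%:E =
    (c * (zeta (s + 3) * zeta (s + 2)))%:E.
  under eq_esum do rewrite EFinM.
  rewrite esumZl//.
  rewrite [RHS]EFinM; congr mule.
  transitivity (\esum_(a in [set: nat]) \esum_(e in [set: nat])
      ((a.+1%:R `^ (- (s + 3)))%:E * (e.+1%:R `^ (- (s + 2)))%:E)%E : \bar R).
    rewrite esum_esum; last first.
      by move=> i j _ _; rewrite -EFinM lee_fin mulr_ge0// powR_ge0.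
    by rewrite (_ : _ `*`` _ = [set: _ * _]); last by apply/seteqP; split.
  have z20 : 0 <= zeta (s + 2).
    rewrite -lee_fin -esum_zeta//.
    by apply: esum_ge0 => n _; rewrite lee_fin powR_ge0.
  transitivity (\esum_(a in [set: nat])
      ((zeta (s + 2))%:E * (a.+1%:R `^ (- (s + 3)))%:E)%E).
    apply: eq_esum => a _; rewrite esumZl ?powR_ge0//.
    by rewrite esum_zeta// muleC.
  rewrite esumZl//.
  by rewrite esum_zeta// -EFinM mulrC.
rewrite -!EFinM; congr _%:E; rewrite /c; field.
by rewrite gt_eqF.
Qed.

End LatticeSum.

(** * Passage from complex lattice triples to pairs of integer vectors *)

Section LatticePoints.
Variables (R : realType) (x y : R).
Hypothesis y0 : 0 < y.
Let z : R[i] := x +i* y.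

Lemma lattice_pointE p : lattice_point z p =
  (p.1%:~R * x + p.2%:~R) +i* (p.1%:~R * y).
Proof.
have intC (m : int) : (m%:~R : R[i]) = m%:~R +i* 0.
  by rewrite -(rmorph_int (real_complex R)).
by rewrite /lattice_point !intC; simpc.
Qed.

Lemma lattice_point_inj : injective (lattice_point z).
Proof.
move=> [m n] [m' n']; rewrite !lattice_pointE/= => -[+ /(mulIf (lt0r_neq0 y0))].
move=> + /intr_inj mm'; rewrite mm' => /addrI /intr_inj ->.
by [].
Qed.

Lemma lattice_pointD p q :
  lattice_point z (p + q) = lattice_point z p + lattice_point z q.
Proof. by rewrite /lattice_point/= !intrD; ring. Qed.

Lemma lattice_pointN p : lattice_point z (- p) = - lattice_point z p.
Proof. by rewrite /lattice_point/= !mulrNz; ring. Qed.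

(** The default of [xget] is never reached, since p itself is a witness; injectivity makes it the
    only one. *)
Lemma lattice_pointK : cancel (lattice_point z) (lattice_coord z).
Proof.
move=> p; rewrite /lattice_coord; case: xgetP => [q _ /lattice_point_inj//|].
by move=> /(_ p)/(_ erefl).
Qed.

Lemma lattice_det_point p q :
  lattice_det z (lattice_point z p) (lattice_point z q) = cross (p, q).
Proof. by rewrite /lattice_det !lattice_pointK; case: p q => [m n] [m' n']. Qed.

Lemma sqr_normc_lattice_point p :
  Normc.normc (lattice_point z p) ^+ 2 = qform x y p.
Proof. by rewrite lattice_pointE /= sqr_sqrtr// addr_ge0// sqr_ge0. Qed.

Definition triple_of (p : (int * int) * (int * int)) : R[i] * R[i] * R[i] :=
  (lattice_point z p.1, lattice_point z p.2, lattice_point z (- (p.1 + p.2))).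

Lemma triple_of_bij :
  set_bij [set p | cross p != 0] (lattice_triples z) triple_of.
Proof.
split => [p /= /eqP p0|p q _ _|[[w1 w2] w3]].
- split; first by split; [exists p.1|exists p.2|exists (- (p.1 + p.2))].
  by rewrite /= lattice_det_point lattice_pointN lattice_pointD subrr; case: p p0.
- by case: p q => [u v] [u' v'] [/lattice_point_inj -> /lattice_point_inj ->].
- move=> [] [[p _ /= <-] [q _ /= <-] _] [pq0 /=]; rewrite lattice_det_point => d0.
  exists (p, q); first exact/eqP.
  congr (_, _, _); rewrite lattice_pointN lattice_pointD.
  by move: pq0 => /eqP; rewrite /= addr_eq0 => /eqP ->; rewrite opprK.
Qed.

End LatticePoints.

Unset Implicit Arguments.

Theorem theorem4 (R : realType) (x y : R) (hy : 0 < y) (s : R) (hs : -1 < s) :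
  let z : R[i] := x +i* y in
  \esum_(t in lattice_triples z)
     (`|(lattice_det z t.1.1 t.1.2)%:~R| `^ (- s)
       / Normc.normc (t.1.1 * t.1.2 * t.2) ^+ 2)%:E
  = (6 * pi / y ^+ 3 * zeta (s + 3) * zeta (s + 2))%:E.
Proof.
move=> z; rewrite (reindex_esum _ _ _ _ (triple_of_bij x hy)) -(esum_cross x hy hs).
apply: eq_esum => -[u v] _; rewrite /triple_of/= (lattice_det_point _ hy).
rewrite !Normc.normcM !exprMn !sqr_normc_lattice_point /wt/=.
congr (_ * (_ * _)^-1)%:E.
(* The third vector is -(u + v), and [qform] is even. *)
by rewrite /qform/= !mulrNz; ring.
Qed.
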